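(* Let $(X,\kappa)$ be a finite $\kappa$-connected digital image having more than one point. If $X$ is irreducible, then $\mathrm{TC}(X,\kappa) > 1$.
   Context: Digital images. For $1\le k\le n$, distinct points $x=(x_1,\dots,x_n)$, $y=(y_1,\dots,y_n)$ of $\mathbb{Z}^n$ are $c_k$-adjacent if $|x_i-y_i|=1$ for at most $k$ indices $i$ and $x_j=y_j$ for every index $j$ with $|x_j-y_j|\neq 1$. In $\mathbb{Z}$, $c_1$ is called $2$-adjacency; in $\mathbb{Z}^2$, $c_1$ is $4$-adjacency and $c_2$ is $8$-adjacency. A digital image $(X,\kappa)$ is a finite subset $X\subset\mathbb{Z}^n$ with such an adjacency relation $\kappa$; write $x\leftrightarrow_\kappa y$ for adjacency. It is $\kappa$-connected if any two distinct points $x,y$ are joined by a finite sequence $x=x_0,\dots,x_m=y$ in $X$ with $x_i\leftrightarrow_\kappa x_{i+1}$. In a product of digital images, two points are adjacent if they are distinct and in each coordinate their components are equal or adjacent. Continuity and homotopy. A map $f:(X,\kappa)\to(Y,\lambda)$ is $(\kappa,\lambda)$-continuous if $x\leftrightarrow_\kappa x'$ implies $f(x)=f(x')$ or $f(x)\leftrightarrow_\lambda f(x')$. The digital interval $[a,b]_{\mathbb{Z}}=\{z\in\mathbb{Z}: a\le z\le b\}$ carries $2$-adjacency. Continuous maps $f,g:X\to Y$ are $(\kappa,\lambda)$-homotopic if for some integer $m\ge 0$ there is $F:X\times[0,m]_{\mathbb{Z}}\to Y$ with $F(x,0)=f(x)$, $F(x,m)=g(x)$ for all $x$, such that $F(\cdot,t)$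 is $(\kappa,\lambda)$-continuous for each $t$ and $F(x,\cdot)$ is $(2,\lambda)$-continuous for each $x$. A continuous $f:X\to Y$ is a homotopy equivalence if there is a continuous $g:Y\to X$ with $g\circ f$ and $f\circ g$ homotopic to the identities. $(X,\kappa)$ is reducible if it is $(\kappa,\kappa)$-homotopy equivalent to a digital image with fewer points, and irreducible otherwise. Topological complexity. A digital path in $X$ is a $(2,\kappa)$-continuous map $\alpha:[0,m]_{\mathbb{Z}}\to X$, $m\ge 0$ arbitrary. $PX$ is the set of all digital paths in $X$; two paths are adjacent if, after extending the one with fewer steps by repeating its last point so both have the same number of steps, their values at each $t$ are equal or $\kappa$-adjacent. Let $\pi:PX\to X\times X$, $\pi(\alpha)=(\alpha(0),\alpha(m))$. For $\kappa$-connected $X$, $\mathrm{TC}(X,\kappa)$ is the minimal $k$ such that $X\times X=U_1\cup\dots\cup U_k$ and for each $j$ there is a digitally continuous $s_j:U_j\to PX$ with $\pi\circ s_j=\mathrm{id}_{U_j}$ ($\infty$ if no such $k$ exists). Here continuity again means that adjacent points have adjacent or equal images. *)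

(* Defs.v *)
From HB Require Import structures.
From mathcomp Require Import all_boot all_order all_algebra finmap.
From mathcomp Require Import boolp constructive_ereal.

Set Implicit Arguments.
Unset Strict Implicit.
Unset Printing Implicit Defensive.

Import Order.TTheory GRing.Theory Num.Theory.

Local Open Scope ring_scope.
Local Open Scope fset_scope.

Definition ck_adj (n k : nat) : rel 'rV[int]_n := fun x y =>
  [&& x != y,
      (#|[set i : 'I_n | (`|x 0 i - y 0 i| == 1)%R]| <= k)%N &
      [forall j : 'I_n, (`|x 0 j - y 0 j| != 1) ==> (x 0 j == y 0 j)]].

(* The digital image (X, c_k): a finite set X of points of Z^n, viewed as a
   finite type, with the adjacency of Z^n restricted to it. *)
Definition image_adj (n k : nat) (X : {fset 'rV[int]_n}) : rel X :=
  fun x y => ck_adj k (val x) (val y).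

Definition digitally_connected (T : finType) (e : rel T) : Prop :=
  forall x y : T, x != y -> connect e x y.

Definition prod_adj (T U : eqType) (eT : rel T) (eU : rel U) : rel (T * U) :=
  fun p q => [&& p != q, (p.1 == q.1) || eT p.1 q.1 &
                         (p.2 == q.2) || eU p.2 q.2].

Definition dcontinuous (T U : Type) (eT : rel T) (eU : rel U) (f : T -> U)
    : Prop :=
  forall x x' : T, eT x x' -> f x = f x' \/ eU (f x) (f x').

(* The digital interval [0, m] is 'I_m.+1; this is its 2-adjacency. *)
Definition interval_adj (m : nat) : rel 'I_m.+1 :=
  fun s t => `|(s : nat)%:Z - (t : nat)%:Z| == 1.

Definition dhomotopic (T U : Type) (eT : rel T) (eU : rel U) (f g : T -> U)
    : Prop :=
  exists (m : nat) (F : T -> 'I_m.+1 -> U),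
    [/\ forall x, F x ord0 = f x,
        forall x, F x ord_max = g x,
        forall t, dcontinuous eT eU (fun x => F x t) &
        forall x, dcontinuous (@interval_adj m) eU (F x)].

Definition dhomotopy_equivalent (T U : Type) (eT : rel T) (eU : rel U)
    : Prop :=
  exists (f : T -> U) (g : U -> T),
    [/\ dcontinuous eT eU f, dcontinuous eU eT g,
        dhomotopic eT eT (g \o f) id & dhomotopic eU eU (f \o g) id].

(* (kappa, kappa)-homotopy equivalence: the smaller image Y carries the same
   adjacency c_k, hence lies in the same Z^n. *)
Definition reducible (n k : nat) (X : {fset 'rV[int]_n}) : Prop :=
  exists Y : {fset 'rV[int]_n}, (#|` Y| < #|` X|)%N /\
    dhomotopy_equivalent (@image_adj n k X) (@image_adj n k Y).

Definition irreducible (n k : nat) (X : {fset 'rV[int]_n}) : Prop :=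
  ~ reducible k X.

Record dpath (T : Type) (e : rel T) := DPath {
  dpath_steps : nat;
  dpath_fun :> 'I_dpath_steps.+1 -> T;
  dpath_continuous : dcontinuous (@interval_adj dpath_steps) e dpath_fun }.

(* The value at time t, the path staying at its last point after its end. *)
Definition dpath_at (T : Type) (e : rel T) (a : dpath e) (t : nat) : T :=
  a (inord (minn t (dpath_steps a))).

Definition dpath_adj (T : eqType) (e : rel T) : rel (dpath e) := fun a b =>
  [forall t : 'I_(maxn (dpath_steps a) (dpath_steps b)).+1,
    (dpath_at a t == dpath_at b t) || e (dpath_at a t) (dpath_at b t)].

Definition dpath_ends (T : Type) (e : rel T) (a : dpath e) : T * T :=
  (a ord0, a ord_max).

Definition has_motion_planner (T : finType) (e : rel T) (k : nat) : Prop :=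
  exists U : 'I_k -> {set T * T},
    [set: T * T] = (\bigcup_(j < k) U j)%SET /\
    forall j : 'I_k, exists s : {p : T * T | p \in U j} -> dpath e,
      dcontinuous (fun p q => prod_adj e e (val p) (val q)) (@dpath_adj T e) s
      /\ forall p, dpath_ends (s p) = val p.

(* Extended integers are only used to have the value +oo available. *)
Definition TC (T : finType) (e : rel T) : \bar int :=
  if pselect (exists k, `[< has_motion_planner e k >]) is left ex
  then (ex_minn ex)%:Z%:E else +oo%E.

(* Main.v *)
Require Import Defs.
From mathcomp Require Import all_boot all_order all_algebra finmap zify.
From mathcomp Require Import boolp constructive_ereal.

(** A digital image with a single motion planner defined on all of X * X is
    contractible: fix a point y0 and let the point x travel along the planned
    path from x to y0.  Moving every x simultaneously deforms the identity into
    the constant map at y0; the deformation is continuous in x because the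
    planner is, and all the paths can be run on one common time interval because
    X is finite and a path rests at its last point after its end.
    A contractible image is homotopy equivalent to a one-point image, so it is
    reducible as soon as it has more than one point.  Hence an irreducible X
    with more than one point has no planner with one domain, and none with zero
    domains as X * X is nonempty. *)

Set Implicit Arguments.
Unset Strict Implicit.
Unset Printing Implicit Defensive.

Section Paths.
Variables (T : eqType) (e : rel T).
Implicit Types a b : dpath e.

Lemma dpath_at0 a : dpath_at a 0 = (dpath_ends a).1.
Proof. by congr (a _); apply/val_inj; rewrite /= inordK min0n. Qed.

Lemma dpath_at_last a t :
  (dpath_steps a <= t)%N -> dpath_at a t = (dpath_ends a).2.
Proof.
by move=> le_at; congr (a _); apply/val_inj; rewrite /= inordK (minn_idPr le_at).
Qed.

Lemma dpath_at_continuous a (t u : nat) :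
  `|t%:Z - u%:Z|%R = 1%R ->
  dpath_at a t = dpath_at a u \/ e (dpath_at a t) (dpath_at a u).
Proof.
move=> tu1; rewrite /dpath_at.
have [->|neq_tu] := eqVneq (minn t (dpath_steps a)) (minn u (dpath_steps a)).
  by left.
apply: dpath_continuous; rewrite /interval_adj !inordK ?ltnS ?geq_minr //.
by apply/eqP; lia.
Qed.

(** The adjacency of paths only constrains the times up to the end of the
    longer path; both paths rest afterwards, so it holds at all times. *)
Lemma dpath_adj_at a b t : dpath_adj a b ->
  dpath_at a t = dpath_at b t \/ e (dpath_at a t) (dpath_at b t).
Proof.
move=> /forallP ab; set m := maxn (dpath_steps a) (dpath_steps b) in ab.
have rest (c : dpath e) : (dpath_steps c <= m)%N -> dpath_at c t = dpath_at c (minn t m).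
  move=> le_cm; rewrite /dpath_at -minnA; congr (c (inord (minn _ _))).
  by rewrite (minn_idPr le_cm).
rewrite (rest a) ?leq_maxl // (rest b) ?leq_maxr //.
have lt_t : (minn t m < m.+1)%N by rewrite ltnS geq_minr.
by case/orP: (ab (Ordinal lt_t)) => [/eqP|]; [left | right].
Qed.

End Paths.

Section Contraction.
Variables (T : finType) (e : rel T).

(** The point x is moved along the path planned for the pair (x, y0).  Adjacent
    points x, x' give adjacent pairs, so their paths stay adjacent at each time.
    The paths are run backwards, from y0 to x: a homotopy equivalence with a
    point asks for a homotopy from the constant map to the identity. *)
Lemma motion_planner1_contractible (y0 : T) :
  has_motion_planner e 1 -> dhomotopic e e (fun _ => y0) id.
Proof.
case=> U [defU planU]; have [s [s_cont s_ends]] := planU ord0.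
have inU p : p \in U ord0.
  by have : p \in [set: T * T] by []; rewrite defU big_ord1.
pose a x : dpath e := s (exist _ (x, y0) (inU (x, y0))).
have a_ends x : dpath_ends (a x) = (x, y0) by rewrite s_ends.
(* By this time every path has reached y0. *)
pose m := \max_x dpath_steps (a x).
exists m, (fun x t => dpath_at (a x) (m - t)); split=> [x|x|t x x' exx'|x t u].
- by rewrite subn0 dpath_at_last ?a_ends // leq_bigmax.
- by rewrite subnn dpath_at0 a_ends.
- (* The pairs must be distinct to be adjacent, and e may be reflexive. *)
  have [->|neq_xx'] := eqVneq x x'; first by left.
  have [|eq_a|adj_a] := s_cont (exist _ (x, y0) (inU _))
                               (exist _ (x', y0) (inU _)).
  + by rewrite /prod_adj /= exx' eqxx orbT xpair_eqE negb_and neq_xx'.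
  + by left; rewrite /a eq_a.
  + exact: dpath_adj_at adj_a.
- rewrite /interval_adj => /eqP tu1; apply: dpath_at_continuous.
  by have := ltn_ord t; have := ltn_ord u; lia.
Qed.

End Contraction.

Lemma dhomotopic_refl (T U : Type) (eT : rel T) (eU : rel U) (f : T -> U) :
  dcontinuous eT eU f -> dhomotopic eT eU f f.
Proof. by exists 0, (fun x _ => f x); split=> // x t u _; left. Qed.

(** The smaller image is the point y0 itself, mapped back to X by inclusion. *)
Lemma contractible_reducible (n k : nat) (X : {fset 'rV[int]_n}) (y0 : X) :
  (1 < #|` X|)%N ->
  dhomotopic (@image_adj n k X) (@image_adj n k X) (fun _ => y0) id ->
  reducible k X.
Proof.
move=> hcard contr; exists [fset val y0]%fset; split; first by rewrite cardfs1.
have Y1 (y : [fset val y0]%fset) : y = [` fset11 (val y0)]%fset.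
  by apply/val_inj/fset1P/valP.
exists (fun _ => [` fset11 (val y0)]%fset), (fun _ => y0); split=> //.
- by move=> x x' _; left.
- by move=> y y' _; left.
- have -> : (fun _ => [` fset11 (val y0)]%fset) \o (fun _ => y0) = id.
    by apply/funext => y; rewrite /= [RHS]Y1.
  by apply: dhomotopic_refl => y y'; right.
Qed.

Lemma motion_planner0_empty (T : finType) (e : rel T) (x : T) :
  ~ has_motion_planner e 0.
Proof.
case=> U [defU _]; have := in_setT (x, x).
by rewrite defU big_ord0 inE.
Qed.

Theorem proposition3p1 (n k : nat) (hk : (1 <= k <= n)%N)
    (X : {fset 'rV[int]_n})
    (hconn : digitally_connected (@image_adj n k X))
    (hcard : (1 < #|` X|)%N)
    (hirr : irreducible k X) :
  (1 < TC (@image_adj n k X))%E.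
Proof.
have [x0 Xx0] : exists x, x \in X by apply/fset0Pn; rewrite -cardfs_gt0 ltnW.
pose y0 : X := [` Xx0]%fset.
rewrite /TC; case: pselect => [ex|_]; last by rewrite ltry.
case: ex_minnP => -[|[|j]] /asboolP plan _.
- by case: (motion_planner0_empty y0 plan).
- case: hirr; apply: (contractible_reducible (y0 := y0)) => //.
  exact: motion_planner1_contractible.
- by rewrite lte_fin.
Qed.
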